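(* For every positive integer $d$, $\alpha_{d,d}=\frac{d}{d+1}$.
   Context: For a finite family $\mathcal{F}$ of convex sets in $\mathbb{R}^d$ and $p\in\mathbb{R}^d$, $\operatorname{dep}_\mathcal{F}(p)$ is the smallest number of sets of $\mathcal{F}$ intersected by a closed halfspace containing $p$. A family is $k$-intersecting if every subfamily of at most $k$ of its members has nonempty intersection. For integers $1\le k\le d+1$, $\alpha_{d,k}$ is the largest real number such that every finite $k$-intersecting family $\mathcal{F}$ of convex sets in $\mathbb{R}^d$ has a point $p$ with $\operatorname{dep}_\mathcal{F}(p)\ge\alpha_{d,k}|\mathcal{F}|$. *)

(* Defs.v *)
From HB Require Import structures.
From mathcomp Require Import all_boot all_order all_algebra.
From mathcomp Require Import all_classical all_reals all_analysis.

Set Implicit Arguments.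
Unset Strict Implicit.
Unset Printing Implicit Defensive.

Import Order.TTheory GRing.Theory Num.Theory.

Local Open Scope classical_set_scope.
Local Open Scope ring_scope.

(* A finite family is indexed by a finType [I], repetitions allowed; its
   cardinality is [#|I|]. *)

Definition closed_halfspace (R : realType) (d : nat) (H : set 'rV[R]_d) : Prop :=
  exists u : 'rV[R]_d, exists c : R,
    u != 0 /\ H = [set x | c <= (x *m u^T) 0 0].

Definition nb_hit (R : realType) (d : nat) (I : finType)
    (F : I -> set 'rV[R]_d) (H : set 'rV[R]_d) : nat :=
  #|[pred i : I | `[< F i `&` H !=set0 >]]|.

Definition halfspace_counts (R : realType) (d : nat) (I : finType)
    (F : I -> set 'rV[R]_d) (p : 'rV[R]_d) : set nat :=
  [set m | exists H, [/\ closed_halfspace H, H p & nb_hit F H = m]].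

(* The default 0 is only reached for d = 0, where there is no halfspace
   (see [dep_min]). *)
Definition dep (R : realType) (d : nat) (I : finType)
    (F : I -> set 'rV[R]_d) (p : 'rV[R]_d) : nat :=
  xget 0%N (halfspace_counts F p `&` lbound (halfspace_counts F p)).

Definition k_intersecting (R : realType) (d k : nat) (I : finType)
    (F : I -> set 'rV[R]_d) : Prop :=
  forall J : {set I}, (#|J| <= k)%N -> \bigcap_(i in [set` J]) F i !=set0.

Definition depth_ratios (R : realType) (d k : nat) : set R :=
  [set a | forall (I : finType) (F : I -> set 'rV[R]_d),
     (forall i, convex_set (F i)) -> k_intersecting k F ->
     exists p : 'rV[R]_d, a * #|I|%:R <= (dep F p)%:R].

Arguments depth_ratios R d k : clear implicits.

(* The greatest element of [depth_ratios R d k]. The default 0 is returned if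
   there is none, so a nonzero value is always a genuine maximum
   (see [alpha_max]). *)
Definition alpha (R : realType) (d k : nat) : R :=
  xget 0 (depth_ratios R d k `&` ubound (depth_ratios R d k)).

Lemma dep_min (R : realType) (d : nat) (I : finType) (F : I -> set 'rV[R]_d)
    (p : 'rV[R]_d) : (0 < d)%N ->
  halfspace_counts F p (dep F p) /\ lbound (halfspace_counts F p) (dep F p).
Proof.
case: d F p => // d F p _; apply: (@xgetPex nat 0%N (halfspace_counts F p `&` lbound _)).
have ne : exists m, `[< halfspace_counts F p m >].
  pose u : 'rV[R]_d.+1 := const_mx 1.
  pose H : set 'rV[R]_d.+1 := [set x | (p *m u^T) 0 0 <= (x *m u^T) 0 0].
  exists (nb_hit F H); apply/asboolP; exists H; split => //; last exact: lexx.
  exists u, ((p *m u^T) 0 0); split => //.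
  by apply/eqP => /rowP/(_ 0); rewrite !mxE => /eqP; rewrite oner_eq0.
case: (ex_minnP ne) => m /asboolP Vm mmin.
by exists m; split => // n Vn; rewrite leEnat; apply/mmin/asboolP.
Qed.

Lemma alpha_max (R : realType) (d k : nat) (a : R) : a != 0 ->
  alpha R d k = a <-> depth_ratios R d k a /\ ubound (depth_ratios R d k) a.
Proof.
move=> a0; split => [|[Va ua]].
  rewrite /alpha; set M := _ `&` _ => aE.
  case: (pselect (exists x, M x)) => [/(xgetPex 0)|nM]; first by rewrite aE.
  by move: a0; rewrite -aE xgetPN ?eqxx// => x Mx; apply: nM; exists x.
apply: xget_unique => // b [Vb ub]; apply/eqP.
by rewrite eq_le ua//= ub.
Qed.

(* Main.v *)
(* Lower bound: a closed halfspace meeting fewer than d/(d+1) of the n sets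
   misses more than n/(d+1) of them, so it avoids the convex hull of their
   union. It thus suffices to find a point common to the hulls of the unions
   of all subfamilies with more than n/(d+1) members, and by Helly's theorem
   only d+1 such subfamilies have to be considered at a time. Two of them share
   a member, by counting; picking it together with one member of each of the
   remaining d-1 subfamilies gives d sets, whose common point lies in all d+1
   hulls.

   Upper bound: take the d+1 hyperplanes x_i = 0 and x_1 + ... + x_d = 1. Any
   point lies in a closed halfspace that misses one of them. *)
Require Import Defs.
From mathcomp Require Import all_boot all_order all_algebra.
From mathcomp Require Import all_classical all_reals all_analysis.
From mathcomp Require Import ring lra zify.
Local Open Scope ring_scope.

Set Implicit Arguments.
Unset Strict Implicit.
Unset Printing Implicit Defensive.

Import Order.TTheory GRing.Theory Num.Theory.

Local Open Scope classical_set_scope.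

(** * Barycenters in convex sets *)

Lemma convex_setP (R : numDomainType) (M : lmodType R) (A : set M) :
  convex_set A <->
  forall (x y : M) (t : R), 0 <= t -> t <= 1 -> A x -> A y ->
    A (t *: x + (1 - t) *: y).
Proof.
split=> [cA x y t t0 t1 Ax Ay|cA x y t /set_mem Ax /set_mem Ay].
  by have /set_mem := cA x y (Itv01 t0 t1) (mem_set Ax) (mem_set Ay).
by apply/mem_set; apply: cA.
Qed.

Lemma convex_set_barycenter (R : realFieldType) (M : lmodType R) (A : set M)
    (T : finType) (P : pred T) (w : T -> R) (x : T -> M) :
  convex_set A -> (forall i, P i -> 0 <= w i) -> (forall i, P i -> A (x i)) ->
  0 < \sum_(i | P i) w i ->
  A ((\sum_(i | P i) w i)^-1 *: \sum_(i | P i) w i *: x i).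
Proof.
move=> /convex_setP cA w0 Ax W0.
have [a Aa] : A !=set0.
  case: (pickP P) => [i Pi|P0]; first by exists (x i); exact: Ax.
  by move: W0; rewrite big_pred0 ?ltxx.
(* [K W v] places v in the dilate of [A] by W. By convexity it is stable under addition, so partial
   sums need no normalisation; [a] serves when the weight is 0. *)
pose K W v := 0 <= W /\ exists2 y, A y & v = W *: y.
have [_ [y Ay ->]] : K (\sum_(i | P i) w i) (\sum_(i | P i) w i *: x i).
  apply: (big_ind2 K) => [|W1 v1 W2 v2 [W10 [y1 Ay1 ->]] [W20 [y2 Ay2 ->]]|i Pi].
  - by split=> //; exists a => //; rewrite scale0r.
  - split; first exact: addr_ge0.
    have [W12|W12] := eqVneq (W1 + W2) 0.
      exists a => //; have [-> ->] : W1 = 0 /\ W2 = 0 by lra.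
      by rewrite addr0 !scale0r addr0.
    have Wpos : 0 < W1 + W2 by rewrite lt_neqAle eq_sym W12 addr_ge0.
    exists (W1 / (W1 + W2) *: y1 + (1 - W1 / (W1 + W2)) *: y2).
      apply: cA => //; first by rewrite divr_ge0// ltW.
      by rewrite ler_pdivrMr// mul1r lerDl.
    by rewrite scalerDr !scalerA; congr (_ *: _ + _ *: _); field.
  - by split; [exact: w0|exists (x i) => //; exact: Ax].
by rewrite scalerA mulVf ?gt_eqF// scale1r.
Qed.

(** * Helly's theorem *)

Lemma affine_dependence (R : fieldType) (d : nat) (T : finType) (A : {set T})
    (x : T -> 'rV[R]_d) : (d.+1 < #|A|)%N ->
  exists l : T -> R, [/\ \sum_(i in A) l i *: x i = 0,
    \sum_(i in A) l i = 0 & exists2 i, i \in A & l i != 0].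
Proof.
move=> dA.
have [a Aa] : exists a, a \in A by apply/card_gt0P; exact: leq_trans dA.
(* With a coordinate 1 appended to each point, affine dependences become linear ones; more than d+1
   rows in dimension d+1 are dependent. *)
pose B : 'M[R]_(#|A|, d + 1) :=
  row_mx (\matrix_i x (enum_val i)) (const_mx 1).
have : kermx B != 0.
  rewrite kermx_eq0 /row_free neq_ltn (leq_ltn_trans (rank_leq_col _))//.
  by rewrite addn1.
case/rowV0Pn => v /sub_kermxP; rewrite mul_mx_row => vB v0.
have [vx v1] : v *m (\matrix_i x (enum_val i)) = 0 :> 'rV_d /\
               v *m const_mx 1 = 0 :> 'rV_1.
  by apply: eq_row_mx; rewrite vB row_mx0.
exists (fun i => v 0 (enum_rank_in Aa i)); split.
- rewrite big_enum_val -[RHS]vx mulmx_sum_row.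
  by apply: eq_bigr => i _; rewrite enum_valK_in rowK.
- rewrite big_enum_val.
  move: v1 => /matrixP/(_ 0 0); rewrite !mxE => v1; rewrite -[RHS]v1.
  by apply: eq_bigr => i _; rewrite enum_valK_in mxE mulr1.
- case/rV0Pn: v0 => i vi.
  by exists (enum_val i); rewrite ?enum_valP// enum_valK_in.
Qed.

(** Induction on [#|A|] by Radon's argument: dropping each index in turn gives points x i lying in
    every other set, and an affine dependence between them is split by sign. *)
Lemma helly (R : realFieldType) (d : nat) (T : finType)
    (C : T -> set 'rV[R]_d) (A : {set T}) :
  (forall i, convex_set (C i)) ->
  (forall J : {set T}, J \subset A -> (#|J| <= d.+1)%N ->
     \bigcap_(i in [set` J]) C i !=set0) ->
  \bigcap_(i in [set` A]) C i !=set0.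
Proof.
move=> cC; have [n] := ubnP #|A|; elim: n A => // n IH A An hA.
have [Ad|dA] := leqP #|A| d.+1; first exact: hA.
have /choice [x xP] : forall i, exists y : 'rV[R]_d,
    i \in A -> forall j, j \in A -> j != i -> C j y.
  move=> i; have [iA|_] := boolP (i \in A); last by exists 0.
  have [||y yP] := IH (A :\ i).
  - by move: An; rewrite (cardsD1 i A) iA.
  - by move=> J JA; apply: hA; apply: fintype.subset_trans JA (subsetDl _ _).
  - by exists y => _ j jA ji; apply: yP => /=; rewrite !inE ji.
have [l [lx l1 [k kA lk]]] := affine_dependence x dA.
rewrite (bigID (fun i => 0 < l i)) /= in lx.
move: l1; rewrite (bigID (fun i => 0 < l i)) /=.
set s := \sum_(i in A | 0 < l i) l i; set s' := \sum_(_ in A | _) _ => ss'.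
have sum0_eq0 (P : pred T) (f : T -> R) : (forall i, P i -> 0 <= f i) ->
    \sum_(i | P i) f i = 0 -> forall i, P i -> f i = 0.
  by move=> f0 /eqP; rewrite psumr_eq0// => /allP h i Pi;
    apply/eqP; move: (h i); rewrite mem_index_enum Pi; apply.
have s0 : 0 <= s by apply: sumr_ge0 => i /andP[_ /ltW].
(* If the positive coefficients summed to 0, so would the others, and all would vanish, against
   [lk]. *)
have spos : 0 < s.
  rewrite lt_neqAle s0 andbT eq_sym; apply/eqP => s00.
  have s'0 : \sum_(i in A | ~~ (0 < l i)) - l i = 0.
    by rewrite sumrN -/s'; lra.
  have [lk0|lk0] := boolP (0 < l k).
    move/eqP: lk; apply; apply: (sum0_eq0 _ l _ s00); last by rewrite kA.
    by move=> i /andP[_ /ltW].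
  move/eqP: lk; apply; apply/oppr_inj; rewrite oppr0.
  apply: (sum0_eq0 _ (fun i => - l i) _ s'0); last by rewrite kA.
  by move=> i /andP[_]; rewrite -leNgt oppr_ge0.
(* Radon point of the x i *)
exists (s^-1 *: \sum_(i in A | 0 < l i) l i *: x i) => j /= jA.
(* If l j is not positive, the positive part only involves x i with i != j, all in [C j]. Otherwise
   the same point is rewritten through the nonpositive part, which avoids j. *)
have [lj|lj] := boolP (0 < l j); last first.
  apply: convex_set_barycenter => // i /andP[iA li]; first exact: ltW.
  by apply: xP => //; apply: contraNneq lj => ->.
have sE : s = \sum_(i in A | ~~ (0 < l i)) - l i by rewrite sumrN -/s'; lra.
have -> : \sum_(i in A | 0 < l i) l i *: x i =
    \sum_(i in A | ~~ (0 < l i)) - l i *: x i.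
  move/eqP: lx; rewrite addr_eq0 => /eqP ->; rewrite -sumrN.
  by apply: eq_bigr => i _; rewrite scaleNr.
rewrite sE; apply: convex_set_barycenter => //; last by rewrite -sE.
  by move=> i /andP[_]; rewrite -leNgt oppr_ge0.
by move=> i /andP[iA li]; apply: xP => //; apply: contraNneq li => <-.
Qed.

(** * Convex hulls, halfspaces and the lower bound *)

Definition hull (R : numDomainType) (M : lmodType R) (A : set M) : set M :=
  \bigcap_(K in [set K : set M | convex_set K /\ A `<=` K]) K.

Lemma convex_hull (R : numDomainType) (M : lmodType R) (A : set M) :
  convex_set (hull A).
Proof.
apply/convex_setP => x y t t0 t1 Ax Ay K KP.
by case: (KP) => /convex_setP cK _; apply: cK => //; [exact: Ax|exact: Ay].
Qed.

Lemma sub_hull (R : numDomainType) (M : lmodType R) (A : set M) :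
  A `<=` hull A.
Proof. by move=> x Ax K [_]; exact. Qed.

Lemma hull_min (R : numDomainType) (M : lmodType R) (A K : set M) :
  convex_set K -> A `<=` K -> hull A `<=` K.
Proof. by move=> cK AK x; apply. Qed.

Lemma convex_halfspaceC (R : realType) (d : nat) (H : set 'rV[R]_d) :
  closed_halfspace H -> convex_set (~` H).
Proof.
move=> [u [c [_ ->]]]; apply/convex_setP => x y t t0 t1 /= /negP hx /negP hy.
apply/negP; rewrite -!ltNge in hx hy *.
rewrite mulmxDl -!scalemxAl mxE [X in X + _]mxE [X in _ + X]mxE.
(* For t > 0 the x-term is strictly below t c, so a weak bound on the y-term suffices, even at t =
   1. *)
have [->|tN0] := eqVneq t 0; first by rewrite mul0r add0r subr0 mul1r.
have tx : t * (x *m u^T) 0 0 < t * c by rewrite ltr_pM2l// lt_neqAle eq_sym tN0.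
have ty : (1 - t) * (y *m u^T) 0 0 <= (1 - t) * c.
  by rewrite ler_wpM2l// ?subr_ge0// ltW.
by rewrite (lt_le_trans (ltr_leD tx ty))// -mulrDl addrC subrK mul1r.
Qed.

Lemma hitting_set (I : finType) (d : nat) (J : {set {set I}}) :
  (0 < d)%N -> (forall S, S \in J -> (#|I| < #|S| * d.+1)%N) ->
  (#|J| <= d.+1)%N ->
  exists2 K : {set I}, (#|K| <= d)%N &
    forall S, S \in J -> exists2 i, i \in K & i \in S.
Proof.
move=> d0 large Jd.
have [->|[S0 S0J]] := set_0Vmem J.
  by exists finset.set0 => [|S]; rewrite ?cards0// inE.
have Jne S : S \in J -> exists i, i \in S.
  by move=> /large SI; apply/card_gt0P; move: SI; case: #|S|.
have [a _] := Jne _ S0J.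
pose f (S : {set I}) := odflt a [pick i in S].
have fS S : S \in J -> f S \in S.
  by move=> /Jne[i iS]; rewrite /f; case: pickP => // /(_ i); rewrite iS.
have [disj|] := boolP (finset.trivIset J).
  exists [set f S | S in J]%SET; last first.
    by move=> S SJ; exists (f S); [exact: imset_f|exact: fS].
  apply: leq_trans (leq_imset_card _ _) _.
  (* With n = [#|I|], disjointness gives |J|(n+1) <= n(d+1) < (n+1)(d+1), so |J| <= d and one
     representative per member is affordable. *)
  have : (\sum_(S in J) #|I|.+1 <= \sum_(S in J) #|S| * d.+1)%N.
    by apply: leq_sum => S /large.
  rewrite sum_nat_const -big_distrl /= (eqP disj).
  move=> JI; rewrite -ltnS -(ltn_pmul2r (ltn0Sn #|I|)) mulnC.
  apply: leq_ltn_trans (_ : #|I| * d.+1 < _)%N.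
    by rewrite mulnC (leq_trans JI)// leq_mul2r max_card orbT.
  by rewrite mulnC ltn_pmul2l.
move/finset.trivIsetP => /existsNP[S /existsNP[S' /not_implyP[SJ]]].
move=> /not_implyP[S'J] /not_implyP[SS' /negP/pred0Pn[i /andP[/= iS iS']]].
(* [i] serves both [S] and [S']; the other members, at most d-1, take one representative each. *)
exists (i |: [set f T | T in J :\ S :\ S'])%SET.
  rewrite (leq_trans (leq_card_setU _ _))// cards1.
  rewrite -ltnS (leq_ltn_trans (leq_add (leqnn 1) (leq_imset_card _ _)))//.
  move: Jd; rewrite (cardsD1 S J) SJ (cardsD1 S' (J :\ S)).
  by rewrite !inE eq_sym SS' S'J.
move=> T TJ.
have [->|TS] := eqVneq T S; first by exists i => //; rewrite !inE eqxx.
have [->|TS'] := eqVneq T S'; first by exists i => //; rewrite !inE eqxx.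
exists (f T); last exact: fS.
by rewrite inE imset_f ?orbT// !inE TS TS'.
Qed.

Lemma centerpoint (R : realType) (d : nat) (I : finType)
    (F : I -> set 'rV[R]_d) : (0 < d)%N -> k_intersecting d F ->
  exists p, forall H, closed_halfspace H -> H p ->
    (d * #|I| <= nb_hit F H * d.+1)%N.
Proof.
move=> d0 kF.
pose C (S : {set I}) := hull (\bigcup_(i in [set` S]) F i).
pose L := [set S : {set I} | (#|I| < #|S| * d.+1)%N]%SET.
have [||p pC] := @helly R d _ C L; first by move=> S; exact: convex_hull.
  move=> J JL Jd.
  have [|K Kd KJ] := hitting_set d0 _ Jd.
    by move=> S /(fintype.subsetP JL); rewrite inE.
  have [x xK] := kF _ Kd; exists x => S /KJ[i iK iS].
  by apply: sub_hull; exists i => //; exact: xK.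
exists p => H hH Hp; rewrite leqNgt; apply/negP => hit.
pose S : {set I} := [set i | ~~ `[< F i `&` H !=set0 >]]%SET.
have cardS : (nb_hit F H + #|S| = #|I|)%N.
  by rewrite -(cardC [pred i | `[< F i `&` H !=set0 >]]) cardsE.
have SL : S \in L by rewrite inE; nia.
have : ~ H p; last by [].
apply: (hull_min (convex_halfspaceC hH) _ (pC S SL)) => x [i /=].
by rewrite inE => /asboolPn Fi Fix Hx; apply: Fi; exists x.
Qed.

(** * The upper bound *)

Definition coord_hyperplane (R : realType) (d : nat) (o : option 'I_d) :
    set 'rV[R]_d :=
  match o with
  | Some i => [set x | x 0 i = 0]
  | None => [set x | \sum_i x 0 i = 1]
  end.

Arguments coord_hyperplane R d o : clear implicits.

Lemma coord_hyperplane_missed (R : realType) (d : nat) (p : 'rV[R]_d) :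
  (0 < d)%N -> exists H o, [/\ closed_halfspace H, H p &
    coord_hyperplane R d o `&` H = set0].
Proof.
move=> d0; have [->|/rV0Pn [i pi]] := eqVneq p 0.
  (* At the origin, the halfspace where the coordinate sum is <= 0 misses the hyperplane where it is
     1. *)
  exists [set x : 'rV[R]_d | 0 <= (x *m (const_mx (-1) : 'rV_d)^T) 0 0], None; split.
  - exists (const_mx (-1)), 0; split=> //; apply/rV0Pn.
    by exists (Ordinal d0); rewrite mxE oppr_eq0 oner_eq0.
  - by rewrite /= mul0mx mxE.
  - rewrite -subset0 => x [/= x1]; rewrite mxE.
    under eq_bigr do rewrite !mxE mulrN1.
    by rewrite sumrN x1 oppr_ge0 ler10.
(* The factor p_i orients the normal: whatever its sign, p_i x_i >= p_i^2 > 0 excludes x_i = 0. *)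
pose u : 'rV[R]_d := p 0 i *: delta_mx 0 i.
have E (x : 'rV[R]_d) : (x *m u^T) 0 0 = p 0 i * x 0 i.
  rewrite !mxE (bigD1 i)//= !mxE !eqxx mulr1 mulrC big1 ?addr0// => j ji.
  by rewrite !mxE (negPf ji) andbF !mulr0.
exists [set x | p 0 i * p 0 i <= (x *m u^T) 0 0], (Some i).
split.
- exists u, (p 0 i * p 0 i); split=> //; apply/rV0Pn.
  by exists i; rewrite !mxE !eqxx mulr1.
- by rewrite /= E.
- rewrite -subset0 => x [/= x0]; rewrite E x0 mulr0 -expr2.
  by rewrite leNgt lt_neqAle sqr_ge0 eq_sym sqrf_eq0 pi.
Qed.

Lemma convex_coord_hyperplane (R : realType) (d : nat) (o : option 'I_d) :
  convex_set (coord_hyperplane R d o).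
Proof.
apply/convex_setP; case: o => [i|] x y t _ _ /= hx hy.
  by rewrite !mxE hx hy !mulr0 addr0.
under eq_bigr do rewrite !mxE.
by rewrite big_split /= -!mulr_sumr hx hy; ring.
Qed.

(** The hyperplanes span the facets of the simplex with vertices 0 and the e_i. At most d of them
    leave one out, and share the vertex opposite to it: e_i for [Some i], 0 for [None]. *)
Lemma coord_hyperplane_intersecting (R : realType) (d : nat) :
  k_intersecting d (coord_hyperplane R d).
Proof.
move=> J Jd; have [k kJ] : exists k, k \notin J.
  apply/existsP; apply: contraTT Jd; rewrite negb_exists -ltnNge.
  move=> /forallP hJ; have -> : J = [set: option 'I_d]%SET.
    by apply/setP => o; rewrite inE; move: (hJ o); rewrite negbK.
  by rewrite cardsT card_option card_ord.
case: k kJ => [i|] kJ.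
  exists (delta_mx 0 i) => -[j|] /= jJ.
    by rewrite mxE eqxx /=; case: eqP => // ji; rewrite -ji jJ in kJ.
  rewrite (bigD1 i)//= mxE !eqxx big1 ?addr0// => j ji.
  by rewrite mxE (negPf ji) andbF.
by exists 0 => -[j|] /= jJ; [rewrite mxE|rewrite jJ in kJ].
Qed.

Theorem theorem5 (R : realType) (d : nat) (hd : (0 < d)%N) :
  alpha R d d = d%:R / d.+1%:R.
Proof.
apply/alpha_max; first by rewrite mulf_neq0 ?invr_eq0 ?pnatr_eq0 -?lt0n.
split=> [I F _ kF|a ha].
  have [p pP] := centerpoint hd kF; exists p.
  have [[H [hH Hp <-]] _] := dep_min F p hd.
  rewrite mulrAC ler_pdivrMr ?ltr0n// -!natrM ler_nat.
  exact: pP.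
(* The family has d+1 members, so a <= d/(d+1) follows once the depth of [p] is at most d. *)
have [p] := ha _ _ (@convex_coord_hyperplane R d)
  (@coord_hyperplane_intersecting R d).
have [_ lb] := dep_min (coord_hyperplane R d) p hd.
rewrite card_option card_ord ler_pdivlMr ?ltr0n// => /le_trans; apply.
rewrite ler_nat.
have [H [k [hH Hp Hk]]] := coord_hyperplane_missed p hd.
have /lb : halfspace_counts (coord_hyperplane R d) p
  (nb_hit (coord_hyperplane R d) H) by exists H.
move=> /leq_trans; apply; rewrite -ltnS.
have -> : d.+1 = #|{: option 'I_d}| by rewrite card_option card_ord.
rewrite /nb_hit -[X in (_ < X)%N](cardC [pred i | `[< coord_hyperplane R d i `&` H !=set0 >]]).
rewrite -[X in (X < _)%N]addn0 ltn_add2l; apply/card_gt0P; exists k.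
by rewrite !inE Hk; apply/asboolPn => -[].
Qed.
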